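(* Let $d\ge2$ be an integer and let job sizes be exponential with mean one. Let $\pi_0(\lambda)\in(0,1]$ denote the probability that the memory is empty when the arrival rate is $\lambda\in(0,1)$. Suppose that $\lim_{\lambda\to1^-}\pi_0'(\lambda)<\infty$ (the limit exists and is finite) and $\lim_{\lambda\to1^-}\pi_0(\lambda)=1$. Then the mean response time $\mathbb{E}[R_\lambda^{(SQ)}]$ of the memory dependent SQ($d$) policy satisfies $$\lim_{\lambda\to1^-}-\frac{\mathbb{E}[R_\lambda^{(SQ)}]}{\log(1-\lambda)}=\frac1{\log(d)},$$ and the mean response time $\mathbb{E}[R_\lambda^{(LL)}]$ of the memory dependent LL($d$) policy satisfies $$\lim_{\lambda\to1^-}-\frac{\mathbb{E}[R_\lambda^{(LL)}]}{\log(1-\lambda)}=\frac1{d-1}.$$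
   Context: Response times are those of the queue at the cavity (large-system approximation) in equilibrium, with arrival rate $\lambda$ per server. $\pi_0(\cdot)$ is differentiable for $\lambda$ near $1$. Put $T_\lambda(x)=\lambda\pi_0(\lambda)x^d$. SQ($d$) with memory: an arriving job is sent to an idle server with probability $1-\pi_0(\lambda)$ (idle server id in memory), and with probability $\pi_0(\lambda)$ it joins the shortest among $d$ independent equilibrium queues. The equilibrium probabilities $u_k$ that a queue has at least $k$ jobs satisfy $u_0=1$, $u_1=\lambda$ and $u_{k+1}=T_\lambda(u_k)$ for $k\ge1$. Service is first-come-first-served with exponential mean-one job sizes, so the number of jobs ahead of an arriving job is at least $k\ge1$ with probability $\pi_0(\lambda)u_k^d$, and $\mathbb{E}[R_\lambda^{(SQ)}]=1+\pi_0(\lambda)\sum_{k\ge1}u_k^d$. LL($d$) with memory: an arriving job is sent to an idle server with probability $1-\pi_0(\lambda)$, and with probability $\pi_0(\lambda)$ it joins the queue with the least workload among $d$ independent equilibrium queues. The equilibrium complementary cdf $\bar F(w)$ of the workload satisfies $\bar F(0)=\lambda$ and $\bar F'(w)=T_\lambda(\bar F(w))-\bar F(w)$ for $w\geq 0$. The waiting time exceeds $w\ge0$ with probability $\pi_0(\lambda)\bar F(w)^d$, so $\mathbb{E}[R_\lambda^{(LL)}]=1+\pi_0(\lambda)\int_0^\infty\bar F(w)^d\,dw$. *)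

(* Defs.v *)
(* Stdlib reals with Coquelicot *)
From Stdlib Require Import Reals.
From Coquelicot Require Import Coquelicot.
Open Scope R_scope.

(* Throughout, [pi0 lam] is the probability that the memory is empty when the
   arrival rate per server is [lam]. *)

Definition T (d : nat) (pi0 : R -> R) (lam x : R) : R :=
  lam * pi0 lam * x ^ d.

(* Equilibrium probability that an SQ(d) queue has at least [k] jobs. *)
Fixpoint u (d : nat) (pi0 : R -> R) (lam : R) (k : nat) : R :=
  match k with
  | O => 1
  | S k' => match k' with
            | O => lam
            | S _ => T d pi0 lam (u d pi0 lam k')
            end
  end.

(* An arriving job finds at least [k >= 1] jobs ahead of it with probability
   [pi0 lam * u_k ^ d].  The index is shifted so that the sum starts at
   [k = 1].  For [1 <= d], [0 < lam < 1] and [0 < pi0 lam <= 1] it converges, because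
   then [u_k <= lam ^ k]. *)
Definition mean_response_SQ (d : nat) (pi0 : R -> R) (lam : R) : R :=
  1 + pi0 lam * Series (fun k : nat => u d pi0 lam (S k) ^ d).

(* [F w = P (W > w)] on [w >= 0], for a finite nonnegative [W]; the values of
   [F] at negative arguments are irrelevant. *)
Definition is_ccdf (F : R -> R) : Prop :=
  F 0 <= 1 /\
  (forall v w : R, 0 <= v -> v <= w -> F w <= F v) /\
  (forall w : R, 0 <= w -> filterlim F (at_right w) (locally (F w))) /\
  filterlim F (Rbar_locally p_infty) (locally 0).

(* Derivative relative to the half-line [0, +oo): two-sided at [w > 0],
   right-sided at [w = 0]. *)
Definition is_derive_halfline (F : R -> R) (w l : R) : Prop :=
  filterlim (fun v : R => (F v - F w) / (v - w))
    (within (fun v : R => 0 <= v) (locally' w)) (locally l).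

Definition is_workload_ccdf_LL
    (d : nat) (pi0 : R -> R) (lam : R) (F : R -> R) : Prop :=
  is_ccdf F /\
  F 0 = lam /\
  (forall w : R, 0 <= w -> is_derive_halfline F w (T d pi0 lam (F w) - F w)).

(* The waiting time exceeds [w >= 0] with probability [pi0 lam * F w ^ d].
   For [0 < lam < 1], [0 < pi0 lam <= 1], [2 <= d] and [F] as in
   [is_workload_ccdf_LL], the improper integral converges, because
   [F w <= lam * exp (- (1 - lam) * w)]. *)
Definition mean_response_LL
    (d : nat) (pi0 : R -> R) (lam : R) (F : R -> R) : R :=
  1 + pi0 lam *
      RInt_gen (fun w : R => F w ^ d) (at_point 0) (Rbar_locally p_infty).

(* Main.v *)
Require Import Defs.
From Stdlib Require Import Reals Lra Lia.
From Coquelicot Require Import Coquelicot.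
Open Scope R_scope.

(** Write [p = pi0 lam], [a = lam * p] and [L = - ln (1 - lam)].  The mean value
    theorem gives [1 - p <= C * (1 - lam)] near [1], so [1 - a] and [1 - lam] are
    comparable, and it suffices to show that the sum and the integral differ from
    [L / ln d] and [L / (d - 1)] by a bounded amount.

    SQ: [u_(k+1)] lies between [a ^ (2 d^k - 1)] and [lam ^ (d^k)], so the terms of
    the sum are close to [1] as long as [d^k] is below [1 / (1 - lam)], and
    negligible afterwards.

    LL: the equation for [F] is of Bernoulli type, and with [n = d - 1] its solution
    is [F^(-n) = a + c * exp (n w)], where [c = lam^(-n) - a] is comparable to
    [1 - lam].  Hence [F^d] is close to [1] up to [w = L / n] and decays
    exponentially afterwards. *)

(** * Limits at 1 from the left: bounded errors and the gap [1 - pi0 lam] *)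

Lemma filterlim_Rplus {U : Type} {F : (U -> Prop) -> Prop} {FF : Filter F}
  (f g : U -> R) (a b c : R) : c = a + b ->
  filterlim f F (locally a) -> filterlim g F (locally b) ->
  filterlim (fun x => f x + g x) F (locally c).
Proof.
intros -> Hf Hg.
exact (filterlim_comp_2 _ _ _ Hf Hg (filterlim_plus (V := R_NormedModule) a b)).
Qed.

Lemma filterlim_Rmult {U : Type} {F : (U -> Prop) -> Prop} {FF : Filter F}
  (f g : U -> R) (a b c : R) : c = a * b ->
  filterlim f F (locally a) -> filterlim g F (locally b) ->
  filterlim (fun x => f x * g x) F (locally c).
Proof.
intros -> Hf Hg.
exact (filterlim_comp_2 _ _ _ Hf Hg (filterlim_mult (K := R_AbsRing) a b)).
Qed.

(** Since [- ln (1 - lam)] tends to infinity, dividing by it removes both the constant 1 and the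
    bounded error [K]; the factor [p] tends to 1. *)
Lemma log_growth_limit (p S : R -> R) (m K : R) :
  filterlim p (at_left 1) (locally 1) ->
  at_left 1 (fun lam => Rabs (S lam - m * - ln (1 - lam)) <= K) ->
  filterlim (fun lam => - ((1 + p lam * S lam) / ln (1 - lam)))
    (at_left 1) (locally m).
Proof.
intros Hp HS.
assert (HL : filterlim (fun lam => / - ln (1 - lam)) (at_left 1) (locally 0)).
{ intros P [eps HP].
  (* [1 - x < exp (- / eps)] is exactly [/ eps < - ln (1 - x)]. *)
  assert (H : 0 < exp (- / eps)) by apply exp_pos.
  exists (mkposreal _ H). intros x Hx Hx1.
  change (Rabs (x - 1) < exp (- / eps)) in Hx.
  rewrite Rabs_left in Hx by lra.
  apply HP. change (Rabs (/ - ln (1 - x) - 0) < eps).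
  pose proof (cond_pos eps).
  assert (H2 : / eps < - ln (1 - x)).
  { assert (ln (1 - x) < - / eps); [|lra].
    rewrite <- (ln_exp (- / eps)). apply ln_increasing; lra. }
  assert (0 < / eps) by (apply Rinv_0_lt_compat; lra).
  assert (0 < / - ln (1 - x)) by (apply Rinv_0_lt_compat; lra).
  rewrite Rminus_0_r, Rabs_pos_eq by lra.
  rewrite <- (Rinv_inv eps). apply Rinv_lt_contravar; [nra|lra]. }
assert (Hneg : at_left 1 (fun lam => 0 < - ln (1 - lam))).
{ exists (mkposreal 1 Rlt_0_1). intros x Hx Hx1.
  change (Rabs (x - 1) < 1) in Hx. rewrite Rabs_left in Hx by lra.
  assert (ln (1 - x) < ln 1) by (apply ln_increasing; lra).
  rewrite ln_1 in H. lra. }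
assert (Hq : filterlim (fun lam => S lam * / - ln (1 - lam)) (at_left 1) (locally m)).
{ apply (filterlim_le_le (F := at_left 1)
    (fun lam => m + - K * / - ln (1 - lam)) _
    (fun lam => m + K * / - ln (1 - lam)) (Finite m)).
  - generalize (filter_and _ _ HS Hneg). apply filter_imp. intros x [H1 H2].
    apply Rabs_le_between in H1.
    assert (H3 : 0 < / - ln (1 - x)) by (apply Rinv_0_lt_compat; lra).
    assert (H4 : m = (m * - ln (1 - x)) * / - ln (1 - x)) by (field; lra).
    split; rewrite H4 at 1; nra.
  - apply (filterlim_Rplus _ _ m 0); [ring|apply filterlim_const|].
    apply (filterlim_Rmult _ _ (- K) 0); [ring|apply filterlim_const|exact HL].
  - apply (filterlim_Rplus _ _ m 0); [ring|apply filterlim_const|].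
    apply (filterlim_Rmult _ _ K 0); [ring|apply filterlim_const|exact HL]. }
apply (filterlim_ext_loc (F := at_left 1)
  (fun lam => / - ln (1 - lam) + p lam * (S lam * / - ln (1 - lam)))).
{ revert Hneg. apply filter_imp. intros x Hx. field. lra. }
apply (filterlim_Rplus _ _ 0 m); [ring|exact HL|].
apply (filterlim_Rmult _ _ 1 m); [ring|exact Hp|exact Hq].
Qed.

(** Near 1 the derivative is at most [Rabs l + 1]. The value [f 1] is unrelated to the limit, so the
    mean value theorem is applied on [[x, y]] with [y < 1], and then [y] tends to 1. *)
Lemma left_limit_gap (f : R -> R) :
  at_left 1 (fun x => ex_derive f x) ->
  (exists l : R, filterlim (Derive f) (at_left 1) (locally l)) ->
  filterlim f (at_left 1) (locally 1) ->
  exists C, 0 <= C /\ at_left 1 (fun x => 1 - f x <= C * (1 - x)).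
Proof.
intros Hd [l Hl] Hf. exists (Rabs l + 1).
split; [pose proof (Rabs_pos l); lra|].
assert (Hb : at_left 1 (fun x => ex_derive f x /\ Rabs (Derive f x - l) < 1)).
{ apply filter_and; [exact Hd|].
  apply (Hl (fun y => Rabs (y - l) < 1)).
  exists (mkposreal 1 Rlt_0_1). intros y Hy. exact Hy. }
destruct Hb as [e He]. exists e. intros x Hx Hx1.
change (Rabs (x - 1) < e) in Hx. rewrite Rabs_left in Hx by lra.
assert (Hd' : forall y, x <= y < 1 -> ex_derive f y /\ Rabs (Derive f y - l) < 1).
{ intros y Hy. apply He; [|lra].
  change (Rabs (y - 1) < e). rewrite Rabs_left; lra. }
apply Rle_minus_l.
assert (Hle : at_left 1 (fun y => f y <= (Rabs l + 1) * (1 - x) + f x)).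
{ assert (H0 : 0 < 1 - x) by lra. exists (mkposreal _ H0). intros y Hy Hy1.
  change (Rabs (y - 1) < 1 - x) in Hy. rewrite Rabs_left in Hy by lra.
  destruct (MVT_gen f x y (Derive f)) as [c [Hc E]].
  - intros z Hz. rewrite Rmin_left, Rmax_right in Hz by lra.
    apply Derive_correct, Hd'. lra.
  - intros z Hz. rewrite Rmin_left, Rmax_right in Hz by lra.
    apply continuity_pt_filterlim, (ex_derive_continuous (V := R_NormedModule)), Hd'. lra.
  - rewrite Rmin_left, Rmax_right in Hc by lra.
    destruct (Hd' c) as [_ H]; [lra|].
    assert (Derive f c <= Rabs l + 1).
    { apply Rabs_lt_between in H. pose proof (Rle_abs l). lra. }
    pose proof (Rabs_pos l). nra. }
exact (filterlim_le (F := at_left 1) f (fun _ => (Rabs l + 1) * (1 - x) + f x) 1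
  (Finite _) Hle Hf (filterlim_const _)).
Qed.

(** * SQ(d) *)

Lemma u_le (d : nat) (pi0 : R -> R) (lam : R) (k : nat) :
  0 <= lam -> 0 <= lam * pi0 lam <= 1 ->
  0 <= u d pi0 lam (S k) <= lam ^ (d ^ k).
Proof.
intros Hl Ha. induction k as [|k IH].
- simpl. lra.
- change (u d pi0 lam (S (S k))) with (lam * pi0 lam * u d pi0 lam (S k) ^ d).
  assert (0 <= u d pi0 lam (S k) ^ d) by (apply pow_le; lra).
  assert (u d pi0 lam (S k) ^ d <= lam ^ (d ^ S k)).
  { rewrite Nat.pow_succ_r', Nat.mul_comm, pow_mult. apply pow_incr. exact IH. }
  split; nra.
Qed.

(** The recursion turns an exponent [e] into [d * e + 1]. From [e = 2 * d^k - 1] this gives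
    [2 * d^(k+1) - d + 1], which is at most [2 * d^(k+1) - 1] because [d >= 2]; a larger exponent
    only weakens the bound. *)
Lemma u_ge (d : nat) (pi0 : R -> R) (lam : R) (k : nat) :
  (2 <= d)%nat -> 0 <= lam * pi0 lam <= 1 -> lam * pi0 lam <= lam ->
  (lam * pi0 lam) ^ (2 * d ^ k - 1) <= u d pi0 lam (S k).
Proof.
intros Hd Ha Hl. induction k as [|k IH].
- simpl. lra.
- change (u d pi0 lam (S (S k))) with (lam * pi0 lam * u d pi0 lam (S k) ^ d).
  set (a := lam * pi0 lam) in *.
  assert (H : (a ^ (2 * d ^ k - 1)) ^ d <= u d pi0 lam (S k) ^ d).
  { apply pow_incr. split; [apply pow_le; lra|exact IH]. }
  rewrite <- pow_mult in H.
  apply Rle_trans with (a ^ S ((2 * d ^ k - 1) * d)).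
  + assert (1 <= d ^ k)%nat by (apply Nat.le_succ_l, Nat.neq_0_lt_0, Nat.pow_nonzero; lia).
    rewrite Nat.pow_succ_r'.
    replace (2 * (d * d ^ k) - 1)%nat
      with (S ((2 * d ^ k - 1) * d) + (d - 2))%nat by nia.
    rewrite pow_add.
    assert (a ^ (d - 2) <= 1) by (rewrite <- (pow1 (d - 2)); apply pow_incr; lra).
    assert (0 <= a ^ S ((2 * d ^ k - 1) * d)) by (apply pow_le; lra). nra.
  + rewrite <- tech_pow_Rmult. apply Rmult_le_compat_l; [lra|exact H].
Qed.

(** * Power inequalities and series with exponents growing like [d^k] *)

Lemma exp_le_compat (x y : R) : x <= y -> exp x <= exp y.
Proof.
intros [H| ->]; [left; apply exp_increasing; exact H|right; reflexivity].
Qed.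

Lemma bernoulli_lower (x : R) (n : nat) :
  0 <= x <= 1 -> 1 - INR n * (1 - x) <= x ^ n.
Proof.
intros Hx. induction n as [|n IH]; [simpl; lra|].
rewrite S_INR. simpl. pose proof (pos_INR n).
assert (x * (1 - INR n * (1 - x)) <= x * x ^ n) by (apply Rmult_le_compat_l; lra).
assert (0 <= INR n * (1 - x) * (1 - x)) by (apply Rmult_le_pos; [apply Rmult_le_pos|]; lra).
nra.
Qed.

(** A companion of Bernoulli's inequality, [q^m * (1 + m (1 - q)) <= 1], holds by induction; for
    [m = n] the bracket is at least 2. *)
Lemma pow_le_half (q : R) (n : nat) :
  0 <= q <= 1 -> 1 <= INR n * (1 - q) -> q ^ n <= / 2.
Proof.
intros Hq Hn.
assert (H : forall m, q ^ m * (1 + INR m * (1 - q)) <= 1).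
{ induction m as [|m IH]; [simpl; lra|].
  rewrite S_INR. simpl. pose proof (pos_INR m).
  assert (0 <= q ^ m) by (apply pow_le; lra).
  assert (q * (1 + (INR m + 1) * (1 - q)) <= 1 + INR m * (1 - q)) by
    (assert (0 <= INR m * (1 - q) * (1 - q)) by
       (apply Rmult_le_pos; [apply Rmult_le_pos|]; lra); nra).
  nra. }
specialize (H n). assert (0 <= q ^ n) by (apply pow_le; lra). nra.
Qed.

(** With [N] the integer part of [- ln (1 - q) / ln d], the first [N + 1] terms are at most 1 each,
    and the remaining ones are dominated by the powers of [/2], whose sum is 2. *)
Lemma lacunary_series_upper (d : nat) (q : R) (v : nat -> R) :
  (2 <= d)%nat -> 0 < q < 1 ->
  (forall k, 0 <= v k <= q ^ (d ^ S k)) ->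
  ex_series v /\ Series v <= - ln (1 - q) / ln (INR d) + 3.
Proof.
intros Hd Hq Hv.
assert (HD : 2 <= INR d) by (apply (le_INR 2); exact Hd).
assert (Hln : 0 < ln (INR d)) by (rewrite <- ln_1; apply ln_increasing; lra).
assert (HL : 0 < - ln (1 - q)).
{ assert (ln (1 - q) < ln 1) by (apply ln_increasing; lra). rewrite ln_1 in H; lra. }
destruct (nfloor_ex (- ln (1 - q) / ln (INR d))) as [N [HN1 HN2]].
{ apply Rlt_le, Rdiv_lt_0_compat; assumption. }
(* The exponential of [- ln (1 - q) < (N + 1) * ln d]. *)
assert (Hbig : 1 <= INR (d ^ S N) * (1 - q)).
{ rewrite pow_INR. rewrite <- (Rpower_pow (S N)) by lra.
  unfold Rpower. rewrite S_INR.
  apply (Rmult_lt_compat_r _ _ _ Hln) in HN2.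
  unfold Rdiv in HN2. rewrite Rmult_assoc, Rinv_l, Rmult_1_r in HN2 by lra.
  apply exp_increasing in HN2.
  rewrite <- ln_Rinv in HN2 by lra.
  rewrite exp_ln in HN2 by (apply Rinv_0_lt_compat; lra).
  apply Rlt_le in HN2.
  apply (Rmult_le_compat_r (1 - q)) in HN2; [|lra].
  rewrite Rinv_l in HN2 by lra. exact HN2. }
pose proof (pow_le_half q (d ^ S N) ltac:(lra) Hbig) as Hhalf.
assert (Htail : forall k, 0 <= v (S N + k)%nat <= (/2) ^ k).
{ intros k. split; [apply Hv|].
  apply Rle_trans with (1 := proj2 (Hv _)).
  apply Rle_trans with ((q ^ (d ^ S N)) ^ k).
  (* The exponent is [d^(N+1) * d^(k+1)] and [d^(k+1) > k], so splitting off [d^(N+1) * k] leaves a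
     factor at most 1. *)
  - rewrite <- pow_mult. replace (d ^ S (S N + k))%nat with (d ^ S N * k + (d ^ S N * (d ^ S k - k)))%nat.
    + rewrite pow_add.
      assert (0 <= q ^ (d ^ S N * k)) by (apply pow_le; lra).
      assert (q ^ (d ^ S N * (d ^ S k - k)) <= 1) by
        (rewrite <- (pow1 (d ^ S N * (d ^ S k - k))); apply pow_incr; lra).
      nra.
    + rewrite <- Nat.mul_add_distr_l.
      assert (S k < d ^ S k)%nat by (apply Nat.pow_gt_lin_r; lia).
      replace (k + (d ^ S k - k))%nat with (d ^ S k)%nat by lia.
      rewrite <- Nat.pow_add_r. f_equal. lia.
  - apply pow_incr. split; [apply pow_le; lra|exact Hhalf]. }
assert (Hgeom : Rabs (/2) < 1) by (rewrite Rabs_pos_eq; lra).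
assert (Hex : ex_series v).
{ apply (ex_series_incr_n v (S N)).
  apply (ex_series_le (K := R_AbsRing) (V := R_CompleteNormedModule) _ (fun k => (/2) ^ k)).
  - intros k. change (Rabs (v (S N + k)%nat) <= (/2) ^ k).
    rewrite Rabs_pos_eq; apply Htail.
  - apply ex_series_geom. exact Hgeom. }
split; [exact Hex|].
rewrite (Series_incr_n v (S N)) by (try lia; exact Hex).
assert (H1 : Series (fun k => v (S N + k)%nat) <= 2).
{ apply Rle_trans with (Series (fun k => (/2) ^ k)).
  - apply Series_le; [exact Htail|apply ex_series_geom; exact Hgeom].
  - rewrite Series_geom by exact Hgeom. lra. }
assert (H2 : sum_f_R0 v (pred (S N)) <= INR N + 1).
{ simpl pred. rewrite <- (Rmult_1_l (INR N + 1)), <- S_INR, <- (sum_cte 1 N).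
  apply sum_Rle. intros k _. apply Rle_trans with (1 := proj2 (Hv k)).
  rewrite <- (pow1 (d ^ S k)). apply pow_incr. lra. }
lra.
Qed.

(** By Bernoulli's inequality term [k] is at least [1 - 2 * d^(k+1) * (1 - a)]. Over the first [N]
    terms, [N] being the integer part of [- ln delta / ln d], the deficits add up to at most
    [4 * (1 - a) * d^N], and [d^N * delta <= 1] bounds this by [4 * C]. *)
Lemma lacunary_series_lower (d : nat) (a delta C : R) (v : nat -> R) :
  (2 <= d)%nat -> 0 <= a <= 1 -> 0 < delta < 1 -> 1 - a <= C * delta ->
  (forall k, a ^ (2 * d ^ S k) <= v k) -> ex_series v ->
  - ln delta / ln (INR d) - 1 - 4 * C <= Series v.
Proof.
intros Hd Ha Hdl HC Hv Hex.
assert (HD : 2 <= INR d) by (apply (le_INR 2); exact Hd).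
assert (Hln : 0 < ln (INR d)) by (rewrite <- ln_1; apply ln_increasing; lra).
assert (HL : 0 < - ln delta).
{ assert (ln delta < ln 1) by (apply ln_increasing; lra). rewrite ln_1 in H; lra. }
destruct (nfloor_ex (- ln delta / ln (INR d))) as [N [HN1 HN2]].
{ apply Rlt_le, Rdiv_lt_0_compat; assumption. }
assert (Hsmall : INR d ^ N * delta <= 1).
{ rewrite <- (Rpower_pow N) by lra. unfold Rpower.
  apply (Rmult_le_compat_r _ _ _ (Rlt_le _ _ Hln)) in HN1.
  unfold Rdiv in HN1. rewrite Rmult_assoc, Rinv_l, Rmult_1_r in HN1 by lra.
  apply exp_le_compat in HN1.
  rewrite <- ln_Rinv in HN1 by lra.
  rewrite exp_ln in HN1 by (apply Rinv_0_lt_compat; lra).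
  apply (Rmult_le_compat_r delta) in HN1; [|lra].
  rewrite Rinv_l in HN1 by lra. exact HN1. }
assert (Hpos : forall k, 0 <= v k).
{ intros k. apply Rle_trans with (2 := Hv k). apply pow_le; lra. }
(* The factor 4 makes the induction close: [4 * d^n + 2 * d^(n+1) <= 4 * d^(n+1)] as [d >= 2]. *)
assert (Hpart : forall n, INR n - 4 * (1 - a) * INR d ^ n + Series (fun k => v (n + k)%nat) <= Series v).
{ induction n as [|n IH].
  - simpl. change (Series (fun k => v k)) with (Series v). lra.
  - rewrite (Series_incr_1 (fun k => v (n + k)%nat)) in IH.
    2:{ apply (ex_series_incr_n v n). exact Hex. }
    rewrite (Series_ext (fun k => v (n + S k)%nat) (fun k => v (S n + k)%nat)) in IH.
    2:{ intros k. f_equal. lia. }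
    rewrite Nat.add_0_r in IH.
    pose proof (Rle_trans _ _ _ (bernoulli_lower a (2 * d ^ S n) Ha) (Hv n)) as H.
    rewrite mult_INR, pow_INR in H. simpl (INR 2) in H. rewrite S_INR.
    simpl pow in *. assert (0 <= INR d ^ n) by (apply pow_le; lra).
    assert (0 <= (1 - a) * INR d ^ n) by (apply Rmult_le_pos; lra). nra. }
specialize (Hpart N).
assert (0 <= Series (fun k => v (N + k)%nat)).
{ rewrite <- (Rmult_0_l (Series (fun k => v (N + k)%nat))), <- Series_scal_l.
  apply Series_le; [|apply (ex_series_incr_n v N); exact Hex].
  intros k. specialize (Hpos (N + k)%nat). lra. }
assert (0 <= INR d ^ N) by (apply pow_le; lra).
assert (0 <= C) by nra.
assert ((1 - a) * INR d ^ N <= C) by nra.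
lra.
Qed.

Lemma SQ_series_bounds (d : nat) (pi0 : R -> R) (lam C : R) :
  (2 <= d)%nat -> 0 < lam < 1 -> 0 < pi0 lam <= 1 ->
  1 - lam * pi0 lam <= C * (1 - lam) ->
  Rabs (Series (fun k => u d pi0 lam (S k) ^ d) - / ln (INR d) * - ln (1 - lam))
    <= 3 + 4 * C.
Proof.
intros Hd Hl Hp HC.
assert (Ha : 0 <= lam * pi0 lam <= 1) by nra.
destruct (lacunary_series_upper d lam (fun k => u d pi0 lam (S k) ^ d)) as [Hex Hup]; auto.
{ intros k. destruct (u_le d pi0 lam k) as [H1 H2]; try lra.
  split; [apply pow_le; exact H1|].
  rewrite Nat.pow_succ_r', Nat.mul_comm, pow_mult. apply pow_incr. lra. }
assert (Hlow := lacunary_series_lower d (lam * pi0 lam) (1 - lam) C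
   (fun k => u d pi0 lam (S k) ^ d) Hd Ha ltac:(lra) HC).
assert (0 <= C) by nra.
unfold Rdiv in *.
apply Rabs_le. split; [|lra].
assert (- ln (1 - lam) * / ln (INR d) - 1 - 4 * C <= Series (fun k => u d pi0 lam (S k) ^ d)); [|lra].
apply Hlow; [|exact Hex].
intros k. apply Rle_trans with (((lam * pi0 lam) ^ (2 * d ^ k - 1)) ^ d).
2:{ apply pow_incr. split; [apply pow_le; lra|]. apply u_ge; auto. nra. }
rewrite <- pow_mult.
(* The bound of [u_ge] raised to the power [d] is better than required by a factor [a^d <= 1]. *)
replace (2 * d ^ S k)%nat with ((2 * d ^ k - 1) * d + d)%nat.
2:{ assert (1 <= d ^ k)%nat by (apply Nat.le_succ_l, Nat.neq_0_lt_0, Nat.pow_nonzero; lia).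
    rewrite Nat.pow_succ_r'. nia. }
rewrite pow_add.
assert ((lam * pi0 lam) ^ d <= 1) by (rewrite <- (pow1 d); apply pow_incr; lra).
assert (0 <= (lam * pi0 lam) ^ ((2 * d ^ k - 1) * d)) by (apply pow_le; lra). nra.
Qed.

(** * LL(d) *)

(** The integrals over [[0, W]] increase with [W] and are bounded, so they converge to their
    supremum. *)
Lemma bounded_integral_converges (f : R -> R) (M : R) :
  (forall x, continuous f x) -> (forall x, 0 <= x -> 0 <= f x) ->
  (forall W, 0 <= W -> RInt f 0 W <= M) ->
  exists l, is_RInt_gen f (at_point 0) (Rbar_locally p_infty) l /\ l <= M /\
    forall W, 0 <= W -> RInt f 0 W <= l.
Proof.
intros Hc Hp HM.
assert (Hex : forall a b, ex_RInt f a b) by (intros; apply (ex_RInt_continuous (V := R_CompleteNormedModule)); auto).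
destruct (completeness (fun y => exists W, 0 <= W /\ y = RInt f 0 W)) as [l [H1 H2]].
{ exists M. intros y [W [HW ->]]. auto. }
{ exists (RInt f 0 0), 0. split; [lra|reflexivity]. }
assert (Hl : forall W, 0 <= W -> RInt f 0 W <= l) by (intros W HW; apply H1; exists W; auto).
exists l. split; [|split; [|exact Hl]].
2:{ apply H2. intros y [W [HW ->]]. auto. }
intros P [eps HP].
assert (Hw : exists W, 0 <= W /\ l - eps < RInt f 0 W).
{ apply Classical_Prop.NNPP. intros Hn.
  assert (l <= l - eps); [|pose proof (cond_pos eps); lra].
  apply H2. intros y [W [HW ->]]. apply Rnot_lt_le. intros H. apply Hn.
  exists W. auto. }
destruct Hw as [W0 [HW0 Hgt]].
apply (Filter_prod _ _ _ (fun x => x = 0) (fun x => W0 < x)); [reflexivity|exists W0; auto|].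
intros x W -> HW. exists (RInt f 0 W). split; [apply (RInt_correct (V := R_CompleteNormedModule)); auto|].
apply HP. change (Rabs (RInt f 0 W - l) < eps).
rewrite <- (RInt_Chasles f 0 W0 W) by auto.
assert (0 <= RInt f W0 W) by (apply RInt_ge_0; auto; [lra|intros; apply Hp; lra]).
assert (RInt f 0 W <= l) by (apply Hl; lra).
rewrite <- (RInt_Chasles f 0 W0 W) in H0 by auto.
change plus with Rplus in *. apply Rabs_lt_between. lra.
Qed.

Lemma RInt_primitive (f F : R -> R) (a b : R) :
  a <= b -> (forall x, is_derive F x (f x)) -> (forall x, ex_derive f x) ->
  ex_RInt f a b /\ RInt f a b = F b - F a.
Proof.
intros Hab HF Hf.
assert (H : is_RInt f a b (F b - F a)).
{ apply (is_RInt_derive (V := R_CompleteNormedModule) F f); [auto|].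
  intros x _. apply (ex_derive_continuous (V := R_NormedModule)), Hf. }
split; [eexists; exact H|apply is_RInt_unique; exact H].
Qed.

(** The upper limit [w0] is where [delta * exp (n * w0) = 1]; up to there the subtracted exponential
    has integral at most [2 * K / n]. *)
Lemma exp_lower_bound_integral (f : R -> R) (n : nat) (delta K : R) :
  (1 <= n)%nat -> 0 < delta < 1 -> 0 <= K ->
  (forall x, continuous f x) ->
  (forall w, 0 <= w -> 1 - 2 * K * delta * exp (INR n * w) <= f w) ->
  / INR n * - ln delta - 2 * K <= RInt f 0 (/ INR n * - ln delta).
Proof.
intros Hn Hd HK Hc Hf.
assert (Hn' : 1 <= INR n) by (apply (le_INR 1); exact Hn).
assert (HL : 0 < - ln delta).
{ assert (ln delta < ln 1) by (apply ln_increasing; lra). rewrite ln_1 in H; lra. }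
assert (Hi : 0 < / INR n <= 1).
{ split; [apply Rinv_0_lt_compat; lra|]. rewrite <- Rinv_1. apply Rinv_le_contravar; lra. }
set (w0 := / INR n * - ln delta).
assert (Hw0 : 0 <= w0) by (unfold w0; nra).
assert (He : delta * exp (INR n * w0) = 1).
{ unfold w0. rewrite <- Rmult_assoc, Rinv_r, Rmult_1_l by lra.
  rewrite exp_Ropp, exp_ln by lra. apply Rinv_r. lra. }
destruct (RInt_primitive (fun w => 1 - 2 * K * delta * exp (INR n * w))
  (fun w => w - 2 * K * delta * exp (INR n * w) * / INR n) 0 w0) as [Hex HI].
{ exact Hw0. }
{ intros x. auto_derive; [exact I|]. field. lra. }
{ intros x. auto_derive. exact I. }
apply Rle_trans with (RInt (fun w => 1 - 2 * K * delta * exp (INR n * w)) 0 w0).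
- rewrite HI. rewrite Rmult_0_r, exp_0.
  replace (2 * K * delta * exp (INR n * w0)) with (2 * K) by (rewrite Rmult_assoc, He; ring).
  assert (0 <= 2 * K * delta * / INR n) by (repeat apply Rmult_le_pos; lra).
  assert (2 * K * / INR n <= 2 * K) by nra. lra.
- apply RInt_le; auto.
  + apply (ex_RInt_continuous (V := R_CompleteNormedModule)); auto.
  + intros x Hx. apply Hf. lra.
Qed.

(** The two bounds on [f] cross at [w0 = - ln delta / n]. The bound 1 contributes at most [w0]
    before this point, the exponential at most [1 / n] after it. *)
Lemma exp_upper_bound_integral (f : R -> R) (n : nat) (delta W : R) :
  (1 <= n)%nat -> 0 < delta < 1 -> 0 <= W ->
  (forall x, continuous f x) ->
  (forall w, 0 <= w -> f w <= 1) ->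
  (forall w, 0 <= w -> f w <= / delta * exp (- (INR n * w))) ->
  RInt f 0 W <= / INR n * - ln delta + 1.
Proof.
intros Hn Hd HW Hc Hf1 Hf2.
assert (Hn' : 1 <= INR n) by (apply (le_INR 1); exact Hn).
assert (HL : 0 < - ln delta).
{ assert (ln delta < ln 1) by (apply ln_increasing; lra). rewrite ln_1 in H; lra. }
assert (Hi : 0 < / INR n <= 1).
{ split; [apply Rinv_0_lt_compat; lra|]. rewrite <- Rinv_1. apply Rinv_le_contravar; lra. }
set (w0 := / INR n * - ln delta).
assert (Hw0 : 0 <= w0) by (unfold w0; nra).
assert (He : / delta * exp (- (INR n * w0)) = 1).
{ unfold w0. rewrite <- Rmult_assoc, Rinv_r, Rmult_1_l by lra.
  rewrite Ropp_involutive, exp_ln by lra. apply Rinv_l. lra. }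
assert (Hex : forall a b, ex_RInt f a b) by (intros; apply (ex_RInt_continuous (V := R_CompleteNormedModule)); auto).
assert (H1 : forall V, 0 <= V -> RInt f 0 V <= V).
{ intros V HV. replace V with (RInt (fun _ => 1) 0 V) at 2.
  - apply RInt_le; auto. apply ex_RInt_const. intros x Hx. apply Hf1; lra.
  - rewrite RInt_const. unfold scal; simpl; unfold mult; simpl. ring. }
destruct (Rle_dec W w0) as [Hle|Hgt]; [specialize (H1 W HW); lra|].
rewrite <- (RInt_Chasles f 0 w0 W) by auto. change plus with Rplus.
apply Rplus_le_compat; [auto|].
destruct (RInt_primitive (fun w => / delta * exp (- (INR n * w)))
  (fun w => - (/ delta * exp (- (INR n * w)) * / INR n)) w0 W) as [Hex' HI].
{ lra. }
{ intros x. auto_derive; [exact I|]. field. lra. }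
{ intros x. auto_derive. exact I. }
apply Rle_trans with (RInt (fun w => / delta * exp (- (INR n * w))) w0 W).
- apply RInt_le; auto; [lra|]. intros x Hx. apply Hf2. lra.
- rewrite HI, He.
  assert (0 < / delta * exp (- (INR n * W)) * / INR n); [|lra].
  repeat apply Rmult_lt_0_compat; try lra; [apply Rinv_0_lt_compat; lra|apply exp_pos].
Qed.

(** * From the half-line to the whole line, and the workload equation *)

Lemma is_derive_of_halfline (F : R -> R) (w l : R) :
  0 < w -> is_derive_halfline F w l -> is_derive (fun v => F (Rmax 0 v)) w l.
Proof.
intros Hw H.
apply (is_derive_ext_loc F).
{ exists (mkposreal w Hw). intros y Hy. change (Rabs (y - w) < w) in Hy.
  apply Rabs_lt_between in Hy. rewrite Rmax_right; [reflexivity|lra]. }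
apply is_derive_Reals. intros eps Heps.
destruct (H (fun y => Rabs (y - l) < eps)) as [[del Hdel] Hd].
{ exists (mkposreal eps Heps). intros y Hy. exact Hy. }
assert (Hm : 0 < Rmin del w) by (apply Rmin_glb_lt; assumption).
exists (mkposreal _ Hm). simpl. intros h Hh0 Hh.
pose proof (Rmin_l del w). pose proof (Rmin_r del w).
assert (Hb : Rabs (w + h - w) < del) by (replace (w + h - w) with h by ring; lra).
specialize (Hd (w + h) Hb). replace (w + h - w) with h in Hd by ring.
apply Hd; [lra|]. apply Rabs_lt_between in Hh. lra.
Qed.

(** Freezing [F] at [F 0] on the negative axis gives a function continuous everywhere; at 0 right
    continuity suffices. *)
Lemma extend_continuous (F : R -> R) :
  filterlim F (at_right 0) (locally (F 0)) ->
  (forall w, 0 < w -> ex_derive (fun v => F (Rmax 0 v)) w) ->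
  forall w, continuous (fun v => F (Rmax 0 v)) w.
Proof.
intros H0 Hd w. destruct (total_order_T 0 w) as [[Hw| <-]|Hw].
- apply (ex_derive_continuous (V := R_NormedModule)), Hd, Hw.
- intros P HP. rewrite Rmax_left in HP by lra.
  destruct (H0 P HP) as [e He]. exists e. intros y Hy.
  destruct (Rle_dec y 0) as [Hle|Hgt].
  + rewrite Rmax_left by lra. apply locally_singleton. exact HP.
  + rewrite Rmax_right by lra. apply He; [exact Hy|lra].
- apply (continuous_ext_loc _ (fun _ => F 0)); [|apply continuous_const].
  assert (Hw' : 0 < - w) by lra. exists (mkposreal _ Hw'). intros y Hy.
  change (Rabs (y - w) < - w) in Hy. apply Rabs_lt_between in Hy.
  rewrite Rmax_left; [reflexivity|lra].
Qed.

(** The point [c] may be 0, where [df c] is only the value of a formula, not an assumed derivative;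
    this is enough to use its sign or its vanishing. *)
Lemma MVT_halfline (f df : R -> R) (w : R) :
  0 <= w -> (forall x, continuous f x) ->
  (forall x, 0 < x -> is_derive f x (df x)) ->
  exists c, 0 <= c <= w /\ f w - f 0 = df c * w.
Proof.
intros Hw Hc Hd.
destruct (MVT_gen f 0 w df) as [c [Hc1 E]].
- intros x Hx. rewrite Rmin_left in Hx by lra. apply Hd. lra.
- intros x _. apply continuity_pt_filterlim, Hc.
- rewrite Rmin_left, Rmax_right in Hc1 by lra. exists c. split; [exact Hc1|].
  rewrite E. ring.
Qed.

Lemma continuous_pow (f : R -> R) (n : nat) (x : R) :
  continuous f x -> continuous (fun y => f y ^ n) x.
Proof.
intros H. apply (continuous_comp f (fun y => y ^ n)); [exact H|].
apply (ex_derive_continuous (V := R_NormedModule)). auto_derive. exact I.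
Qed.

(* The Bernoulli equation [G' = a G^(n+1) - G] is linear in [G^(-n)]. *)
Lemma bernoulli_ode_solution (G : R -> R) (n : nat) (a lam : R) :
  0 <= a -> 0 < lam -> G 0 = lam -> (forall w, 0 <= G w) ->
  (forall w, continuous G w) ->
  (forall w, 0 < w -> is_derive G w (a * G w ^ S n - G w)) ->
  forall w, 0 <= w ->
    0 < G w /\ (/ G w) ^ n = a + ((/ lam) ^ n - a) * exp (INR n * w).
Proof.
intros Ha Hlam H0 Hnn Hc Hd.
(* With the integrating factor, [G v * exp v] has derivative [a * G^(n+1) * exp v >= 0], so it never
   drops below [lam]. *)
assert (Hpos : forall w, 0 <= w -> 0 < G w).
{ intros w Hw.
  destruct (MVT_halfline (fun v => G v * exp v) (fun v => a * G v ^ S n * exp v) w)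
    as [c [Hcw E]]; [exact Hw| | |].
  - intros x. apply (continuous_mult (K := R_AbsRing)); [apply Hc|].
    apply (ex_derive_continuous (V := R_NormedModule)). auto_derive. exact I.
  - intros x Hx. auto_derive; [exists (a * G x ^ S n - G x); auto|].
    replace (Derive (fun y => G y) x) with (a * G x ^ S n - G x)
      by (symmetry; apply is_derive_unique, Hd, Hx). ring.
  - rewrite H0, exp_0 in E.
    assert (0 <= a * G c ^ S n * exp c * w).
    { repeat apply Rmult_le_pos; auto; [apply pow_le; auto|left; apply exp_pos]. }
    destruct (Hnn w) as [Hg|Hg]; [exact Hg|]. rewrite <- Hg in E. lra. }
intros w Hw. split; [auto|].
(* Strict positivity is known only on [[0, +oo)]; composing with [Rmax 0] makes the inverse
   continuous on the whole line. *)
assert (Hpos' : forall x, 0 < G (Rmax 0 x)) by (intros; apply Hpos, Rmax_l).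
assert (Hcm : forall x, continuous (Rmax 0) x).
{ intros x. apply (continuous_ext (fun y => (y + Rabs y) / 2)).
  - intros y. unfold Rmax, Rabs. destruct (Rle_dec 0 y), (Rcase_abs y); lra.
  - apply (continuous_mult (K := R_AbsRing)); [|apply continuous_const].
    apply (continuous_plus (V := R_NormedModule)); [apply continuous_id|].
    apply continuous_Rabs. }
(* [H = G^(-n)] satisfies [H' = n * (H - a)], so [(H - a) * exp (- n v)] is constant. *)
destruct (MVT_halfline
  (fun v => ((/ G (Rmax 0 v)) ^ n - a) * exp (- (INR n * v))) (fun _ => 0) w)
  as [c [_ E]]; [exact Hw| | |].
- intros x. apply (continuous_mult (K := R_AbsRing)).
  + apply (continuous_plus (V := R_NormedModule)); [|apply continuous_const].
    apply continuous_pow. apply (continuous_comp (fun y => G (Rmax 0 y)) Rinv).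
    * apply (continuous_comp (Rmax 0) G); [apply Hcm|apply Hc].
    * apply (ex_derive_continuous (V := R_NormedModule)). auto_derive.
      specialize (Hpos' x). lra.
  + apply (ex_derive_continuous (V := R_NormedModule)). auto_derive. exact I.
- intros x Hx.
  apply (is_derive_ext_loc (fun v => ((/ G v) ^ n - a) * exp (- (INR n * v)))).
  { exists (mkposreal x Hx). intros y Hy. change (Rabs (y - x) < x) in Hy.
    apply Rabs_lt_between in Hy. rewrite Rmax_right; [reflexivity|lra]. }
  assert (Hx' := Hpos x (Rlt_le _ _ Hx)).
  auto_derive.
  { repeat split; [exists (a * G x ^ S n - G x); auto|lra]. }
  replace (Derive (fun y => G y) x) with (a * G x ^ S n - G x)
      by (symmetry; apply is_derive_unique, Hd, Hx).
  rewrite pow_inv.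
  destruct n as [|n]; [simpl; ring|].
  simpl pred. rewrite pow_inv. simpl pow. field.
  split; [apply pow_nonzero|]; lra.
- rewrite !Rmax_right in E by lra.
  rewrite H0, Rmult_0_r, Ropp_0, exp_0, Rmult_0_l, Rmult_1_r in E.
  assert (E' : ((/ G w) ^ n - a) * exp (- (INR n * w)) = (/ lam) ^ n - a) by lra.
  rewrite <- E'. rewrite Rmult_assoc, <- exp_plus, Rplus_opp_l, exp_0. ring.
Qed.

Lemma ccdf_nonneg (F : R -> R) (w : R) : is_ccdf F -> 0 <= w -> 0 <= F w.
Proof.
intros (_ & Hm & _ & Hl) Hw.
apply (filterlim_le (F := Rbar_locally p_infty) F (fun _ => F w) 0 (F w)).
- exists w. intros v Hv. apply Hm; lra.
- exact Hl.
- apply filterlim_const.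
Qed.

(** The explicit solution places [F^(n+1)] between [1 - 2 K (1 - lam) exp (n w)] and both 1 and
    [exp (- n w) / (1 - lam)], so the two integral bounds apply with [delta = 1 - lam]. *)
Lemma LL_integral_bounds (n : nat) (pi0 : R -> R) (lam C : R) (F : R -> R) :
  (1 <= n)%nat -> / 2 <= lam < 1 -> 0 < pi0 lam <= 1 ->
  1 - lam * pi0 lam <= C * (1 - lam) ->
  is_workload_ccdf_LL (S n) pi0 lam F ->
  Rabs (RInt_gen (fun w => F w ^ S n) (at_point 0) (Rbar_locally p_infty)
        - / INR n * - ln (1 - lam)) <= 1 + 2 * (INR n * 2 ^ n + C).
Proof.
intros Hn Hl Hp HC (Hcc & HF0 & HFd).
set (a := lam * pi0 lam) in *.
assert (Ha : 0 <= a <= lam) by (unfold a; nra).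
assert (HC0 : 0 <= C) by nra.
assert (Hn' : 1 <= INR n) by (apply (le_INR 1); exact Hn).
set (G := fun v => F (Rmax 0 v)).
assert (HGF : forall w, 0 <= w -> G w = F w).
{ intros w Hw. unfold G. rewrite Rmax_right; auto. }
assert (HGd : forall w, 0 < w -> is_derive G w (a * G w ^ S n - G w)).
{ intros w Hw. rewrite HGF by lra. apply is_derive_of_halfline; [exact Hw|].
  apply HFd. lra. }
assert (HGc : forall w, continuous G w).
{ apply extend_continuous.
  - destruct Hcc as (_ & _ & Hr & _). apply Hr. lra.
  - intros w Hw. eexists. apply HGd, Hw. }
assert (HG0 : G 0 = lam) by (rewrite HGF by lra; exact HF0).
assert (HGn : forall w, 0 <= G w) by (intros w; apply (ccdf_nonneg F (Rmax 0 w) Hcc), Rmax_l).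
assert (Hsol := bernoulli_ode_solution G n a lam (proj1 Ha) ltac:(lra) HG0 HGn HGc HGd).
set (c := (/ lam) ^ n - a) in *.
assert (Hc1 : 1 - lam <= c).
{ unfold c. rewrite pow_inv.
  assert (1 <= / lam ^ n); [|lra].
  rewrite <- Rinv_1. apply Rinv_le_contravar; [apply pow_lt; lra|].
  rewrite <- (pow1 n). apply pow_incr. lra. }
(* Here [c = (lam^(-n) - 1) + (1 - a)]. As [lam >= / 2], the first part is at most
   [2^n * (1 - lam^n) <= 2^n * n * (1 - lam)]; the second is at most [C * (1 - lam)]. *)
set (K := INR n * 2 ^ n + C).
assert (Hc2 : c <= K * (1 - lam)).
{ unfold c, K.
  assert (H1 : (/ lam) ^ n <= 2 ^ n).
  { apply pow_incr. split; [left; apply Rinv_0_lt_compat; lra|].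
    rewrite <- (Rinv_inv 2). apply Rinv_le_contravar; lra. }
  assert (H2 : (/ lam) ^ n * lam ^ n = 1).
  { rewrite <- Rpow_mult_distr, Rinv_l, pow1; lra. }
  assert (H3 := bernoulli_lower lam n ltac:(lra)).
  assert (0 <= INR n * (1 - lam)) by (apply Rmult_le_pos; lra).
  assert (0 <= (/ lam) ^ n) by (apply pow_le; left; apply Rinv_0_lt_compat; lra).
  nra. }
assert (HK : 0 <= K) by (unfold K; assert (0 < 2 ^ n) by (apply pow_lt; lra); nra).
assert (HG1 : forall w, 0 <= w -> G w <= 1).
{ intros w Hw. rewrite HGF by exact Hw. destruct Hcc as (_ & Hm & _).
  assert (F w <= F 0) by (apply Hm; lra). lra. }
assert (Hprod : forall w, 0 <= w -> G w ^ n * (a + c * exp (INR n * w)) = 1).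
{ intros w Hw. destruct (Hsol w Hw) as [Hg <-].
  rewrite <- Rpow_mult_distr, Rinv_r, pow1; lra. }
assert (Hpn : forall w, 0 <= w -> 0 <= G w ^ n <= 1).
{ intros w Hw. split; [apply pow_le; auto|].
  rewrite <- (pow1 n). apply pow_incr. auto. }
assert (Hup1 : forall w, 0 <= w -> G w ^ S n <= 1).
{ intros w Hw. rewrite <- (pow1 (S n)). apply pow_incr. auto. }
(* Drop [a >= 0] in [Hprod] and use [c >= 1 - lam]. *)
assert (Hup2 : forall w, 0 <= w -> G w ^ S n <= / (1 - lam) * exp (- (INR n * w))).
{ intros w Hw. specialize (Hprod w Hw). specialize (Hpn w Hw).
  assert (G w ^ S n <= G w ^ n).
  { simpl. pose proof (HG1 w Hw). pose proof (HGn w). nra. }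
  rewrite exp_Ropp. pose proof (exp_pos (INR n * w)).
  rewrite <- Rinv_mult. apply Rle_trans with (1 := H).
  assert (Hq : 0 < (1 - lam) * exp (INR n * w)) by (apply Rmult_lt_0_compat; lra).
  apply (Rmult_le_reg_r _ _ _ Hq). rewrite Rinv_l by lra.
  rewrite <- Hprod. apply Rmult_le_compat_l; [lra|]. nra. }
(* With [g = G^n] and [x = c * exp (n w)], [Hprod] gives [1 = g * (a + x) <= g + x]. As [G >= g], it
   follows that [G^(n+1) >= g^2 >= 2 g - 1 >= 1 - 2 x]. *)
assert (Hlow : forall w, 0 <= w -> 1 - 2 * K * (1 - lam) * exp (INR n * w) <= G w ^ S n).
{ intros w Hw. specialize (Hprod w Hw). specialize (Hpn w Hw).
  pose proof (exp_pos (INR n * w)) as He.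
  assert (G w ^ n <= G w).
  { destruct n as [|m]; [lia|]. simpl. pose proof (HG1 w Hw). pose proof (HGn w).
    assert (G w ^ m <= 1) by (rewrite <- (pow1 m); apply pow_incr; auto). nra. }
  assert (G w ^ n * G w ^ n <= G w ^ S n) by (simpl; nra).
  assert (Hx : c * exp (INR n * w) <= K * (1 - lam) * exp (INR n * w)) by nra.
  set (g := G w ^ n) in *. set (x := c * exp (INR n * w)) in *.
  set (y := K * (1 - lam) * exp (INR n * w)) in *.
  replace (2 * K * (1 - lam) * exp (INR n * w)) with (2 * y) by (unfold y; ring).
  assert (0 <= x) by (unfold x; nra).
  assert (1 - x <= g) by nra.
  assert (1 - 2 * g + g * g >= 0) by (pose proof (Rle_0_sqr (1 - g)); unfold Rsqr in *; lra).
  lra. }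
assert (Hcd : forall w, continuous (fun v => G v ^ S n) w) by (intros; apply continuous_pow, HGc).
destruct (bounded_integral_converges (fun v => G v ^ S n) (/ INR n * - ln (1 - lam) + 1))
  as (I & HI & HI1 & HI2).
{ exact Hcd. }
{ intros x Hx. apply pow_le. auto. }
{ intros W HW. apply exp_upper_bound_integral; auto. lra. }
rewrite (is_RInt_gen_unique (V := R_CompleteNormedModule) (fun w => F w ^ S n) I).
2:{ apply (is_RInt_gen_ext (V := R_NormedModule) (fun v => G v ^ S n)); [|exact HI].
  apply (Filter_prod _ _ _ (fun x => x = 0) (fun x => 0 < x)); [reflexivity|exists 0; auto|].
  intros x y -> Hy z Hz. simpl in Hz. rewrite Rmin_left in Hz by lra.
  rewrite HGF; [reflexivity|lra]. }
assert (Hlo := exp_lower_bound_integral (fun v => G v ^ S n) n (1 - lam) K Hn ltac:(lra) HK Hcd Hlow).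
assert (HL : 0 < - ln (1 - lam)).
{ assert (ln (1 - lam) < ln 1) by (apply ln_increasing; lra). rewrite ln_1 in H; lra. }
assert (0 < / INR n) by (apply Rinv_0_lt_compat; lra).
assert (RInt (fun v => G v ^ S n) 0 (/ INR n * - ln (1 - lam)) <= I).
{ apply HI2. apply Rmult_le_pos; lra. }
apply Rabs_le. fold K. lra.
Qed.

(** * The two limits from the bounded-error estimates *)

Theorem theorem7 (d : nat) (pi0 : R -> R) (Fbar : R -> R -> R)
  (hd : (2 <= d)%nat)
  (hpi0 : forall lam : R, 0 < lam < 1 -> 0 < pi0 lam <= 1)
  (hdiff : at_left 1 (fun lam : R => ex_derive pi0 lam))
  (hderiv : exists l : R, filterlim (Derive pi0) (at_left 1) (locally l))
  (hlim : filterlim pi0 (at_left 1) (locally 1))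
  (hF : forall lam : R, 0 < lam < 1 ->
     is_workload_ccdf_LL d pi0 lam (Fbar lam)) :
  filterlim (fun lam : R => - (mean_response_SQ d pi0 lam / ln (1 - lam)))
    (at_left 1) (locally (1 / ln (INR d)))
  /\
  filterlim
    (fun lam : R => - (mean_response_LL d pi0 lam (Fbar lam) / ln (1 - lam)))
    (at_left 1) (locally (1 / (INR d - 1))).
Proof.
destruct (left_limit_gap pi0 hdiff hderiv hlim) as (C & HC & Hgap).
(* [1 - lam * p = (1 - lam) + lam * (1 - p)], and the last term is at most [C * (1 - lam)]. *)
assert (Hnear : at_left 1 (fun lam => / 2 <= lam < 1 /\
  1 - lam * pi0 lam <= (1 + C) * (1 - lam))).
{ assert (Hh : 0 < / 2) by lra.
  assert (Hhalf : at_left 1 (fun lam => / 2 <= lam < 1)).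
  { exists (mkposreal _ Hh). intros x Hx Hx1. change (Rabs (x - 1) < / 2) in Hx.
    apply Rabs_lt_between in Hx. lra. }
  generalize (filter_and _ _ Hgap Hhalf). apply filter_imp.
  intros x [H1 H2]. split; [exact H2|].
  assert (0 < pi0 x <= 1) by (apply hpi0; lra). nra. }
(* Only the two limit values become inverses; the quotients by [ln (1 - lam)] keep the shape of
   [log_growth_limit]. *)
unfold Rdiv at 2 4. rewrite !Rmult_1_l. split.
- apply (log_growth_limit pi0 _ _ (3 + 4 * (1 + C)) hlim).
  revert Hnear. apply filter_imp. intros x [H1 H2].
  apply SQ_series_bounds; [exact hd|lra|apply hpi0; lra|exact H2].
- destruct d as [|n]; [lia|].
  replace (INR (S n) - 1) with (INR n) by (rewrite S_INR; ring).
  apply (log_growth_limit pi0 _ _ (1 + 2 * (INR n * 2 ^ n + (1 + C))) hlim).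
  revert Hnear. apply filter_imp. intros x [H1 H2].
  apply (LL_integral_bounds n pi0); [lia|exact H1|apply hpi0; lra|exact H2|].
  apply hF. lra.
Qed.
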